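(* Let $\mathbf X\in\mathbb C^{D\times N}$, let $K$ be an integer with $1\le K<\operatorname{rank}(\mathbf X)$, let $\mathbf B^{(0)}\in U^{N\times K}$ be arbitrary, and let $$\mathbf B^{(i)}=\operatorname{sgn}\big(\mathbf X^H\operatorname{unt}(\mathbf X\mathbf B^{(i-1)})\big),\qquad i=1,2,\dots$$ Then the sequence $\{\|\mathbf X\mathbf B^{(i)}\|_*\}_{i\ge 0}$ converges: it is monotonically nondecreasing and bounded above by $\max_{\mathbf B\in U^{N\times K}}\|\mathbf X\mathbf B\|_*$, i.e. for every $i\ge 1$, $\|\mathbf X\mathbf B^{(i-1)}\|_*\le\|\mathbf X\mathbf B^{(i)}\|_*\le\max_{\mathbf B\in U^{N\times K}}\|\mathbf X\mathbf B\|_*$.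
   Context: $U=\{z\in\mathbb C:|z|=1\}$, and $U^{N\times K}$ is the set of $N\times K$ matrices with all entries in $U$. $\|\cdot\|_*$ is the nuclear norm (sum of singular values), $(\cdot)^H$ conjugate transpose. For nonzero $z\in\mathbb C$, $\operatorname{sgn}(z)=z/|z|$; $\operatorname{sgn}(0)$ may be any element of $U$; $\operatorname{sgn}$ of a matrix is applied entrywise. For $\mathbf A\in\mathbb C^{m\times n}$ with $m\ge n$, $\operatorname{unt}(\mathbf A)$ denotes a matrix maximizing $\Re\{\operatorname{Tr}(\mathbf Q^H\mathbf A)\}$ over $\mathbf Q\in\mathbb C^{m\times n}$ with $\mathbf Q^H\mathbf Q=\mathbf I_n$; such a matrix is $\mathbf U\mathbf V^H$, where $\mathbf A=\mathbf U\operatorname{Diag}(\boldsymbol\sigma)\mathbf V^H$ is an SVD with $\mathbf U\in\mathbb C^{m\times n}$, $\mathbf V\in\mathbb C^{n\times n}$, $\mathbf U^H\mathbf U=\mathbf V^H\mathbf V=\mathbf I_n$. When $\operatorname{sgn}$ or $\operatorname{unt}$ is not unique, any choice may be made at each step. *)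

(* Defs.v *)
From HB Require Import structures.
From mathcomp Require Import all_boot all_order all_algebra.
From mathcomp Require Import complex.
From mathcomp Require Import all_classical all_reals topology normedtype sequences.

Set Implicit Arguments.
Unset Strict Implicit.
Unset Printing Implicit Defensive.

Import Order.TTheory GRing.Theory Num.Theory.
Import numFieldNormedType.Exports.

Local Open Scope classical_set_scope.
Local Open Scope ring_scope.
Local Open Scope complex_scope.
Local Open Scope sesquilinear_scope.

(* The complex field is R[i] for a realType R; M ^t* is the conjugate
   transpose. *)

Definition unimodular (R : realType) (N K : nat) : set 'M[R[i]]_(N, K) :=
  [set B | forall i j, `|B i j| = 1].

(* The singular values of A are the square roots of the eigenvalues, counted
   with multiplicity, of the positive semidefinite Hermitian matrix A^H A.
   All n of them are listed; when m < n this only adds zeros. *)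
Definition singular_values (R : realType) (m n : nat) (A : 'M[R[i]]_(m, n)) :
    'rV[R]_n :=
  \row_j Num.sqrt (complex.Re (spectral_diag (A ^t* *m A) 0 j)).

Definition nuclear_norm (R : realType) (m n : nat) (A : 'M[R[i]]_(m, n)) : R :=
  \sum_j singular_values A 0 j.

(* sgn and unt are set-valued, so they are relations: S is a possible value of
   the entrywise sgn of A, Q is a possible value of unt A. *)
Definition is_sgn (R : realType) (m n : nat) (A S : 'M[R[i]]_(m, n)) : Prop :=
  forall i j,
    (A i j != 0 -> S i j = A i j / `|A i j|) /\ (A i j = 0 -> `|S i j| = 1).

Definition is_unt (R : realType) (m n : nat) (A Q : 'M[R[i]]_(m, n)) : Prop :=
  Q ^t* *m Q = 1%:M /\
  forall P : 'M[R[i]]_(m, n), P ^t* *m P = 1%:M ->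
    complex.Re (\tr (P ^t* *m A)) <= complex.Re (\tr (Q ^t* *m A)).

(* Agreement with the SVD description of singular values: nuclear_norm A is the
   sum of the diagonal of any thin SVD of A. *)
Lemma nuclear_norm_svd (R : realType) (m n : nat) (A U : 'M[R[i]]_(m, n))
    (V : 'M[R[i]]_n) (s : 'rV[R]_n) :
  U ^t* *m U = 1%:M -> V ^t* *m V = 1%:M -> (forall j, 0 <= s 0 j) ->
  A = U *m diag_mx (map_mx (real_complex R) s) *m V ^t* ->
  nuclear_norm A = \sum_j s 0 j.
Proof.
move=> UU VV s0 AE.
set G := A ^t* *m A.
set d := map_mx (real_complex R) (\row_j (s 0 j ^+ 2)).
have adj p q r (M : 'M[R[i]]_(p, q)) (M' : 'M[R[i]]_(q, r)) :
  (M *m M') ^t* = M' ^t* *m M ^t* by rewrite trmx_mul map_mxM.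
have dd : (diag_mx (map_mx (real_complex R) s)) ^t*
          = diag_mx (map_mx (real_complex R) s).
  rewrite tr_diag_mx map_diag_mx; congr diag_mx; apply/rowP => j.
  by rewrite !mxE; apply: CrealP; rewrite complex_real.
have GE : G = V *m diag_mx d *m V ^t*.
  rewrite /G AE !adj trmxCK dd -!mulmxA (mulmxA _ U) UU mul1mx.
  congr (_ *m _); rewrite !mulmxA; congr (_ *m _).
  rewrite mulmx_diag; congr diag_mx; apply/rowP => j.
  by rewrite !mxE -rmorphM expr2.
have VU : V *m V ^t* = 1%:M by exact: mulmx1C.
have eG : \prod_j ('X - (spectral_diag G 0 j)%:P) = \prod_j ('X - (d 0 j)%:P).
  have cp (P Q : 'M[R[i]]_n) (e : 'rV[R[i]]_n) : P *m Q = 1%:M ->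
      char_poly (P *m diag_mx e *m Q) = \prod_j ('X - (e 0 j)%:P).
    move=> PQ; transitivity (char_poly (diag_mx e)); last first.
      rewrite char_poly_trig ?diag_mx_is_trig //.
      by apply: eq_bigr => j _; rewrite mxE eqxx mulr1n.
    have PQX : map_mx polyC P *m map_mx polyC Q = 1%:M.
      by rewrite -map_mxM PQ map_mx1.
    rewrite [LHS]/char_poly /char_poly_mx !map_mxM.
    have -> : 'X%:M = map_mx polyC P *m 'X%:M *m map_mx polyC Q :> 'M_n.
      by rewrite mul_mx_scalar -scalemxAl PQX scalemx1.
    by rewrite -mulmxBl -mulmxBr !det_mulmx mulrAC -det_mulmx PQX det1 mul1r.
  have Gn : G \is normalmx.
    by apply/normalmxP; rewrite /G adj trmxCK.
  rewrite -(cp V (V ^t*) d VU) -GE.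
  rewrite [in RHS](orthomx_spectralP Gn) cp // mulVmx //.
  exact: spectral_unit.
have pe : perm_eq (codom (spectral_diag G 0)) (codom (d 0)).
  by apply: prod_XsubC_eq; rewrite /codom !big_image.
rewrite /nuclear_norm.
transitivity (\sum_(z <- codom (spectral_diag G 0)) Num.sqrt (complex.Re z)).
  rewrite /codom big_image; apply: eq_bigr => j _.
  by rewrite !mxE.
rewrite (perm_big _ pe) /codom big_image; apply: eq_bigr => j _.
transitivity (Num.sqrt (complex.Re (d 0 j))) => //.
by rewrite !mxE /= sqrtr_sqr ger0_norm.
Qed.

(* Main.v *)
Require Import Defs.
From HB Require Import structures.
From mathcomp Require Import all_boot all_order all_algebra.
From mathcomp Require Import complex.
From mathcomp Require Import all_classical all_reals topology normedtype sequences.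
From mathcomp Require Import derive.
From mathcomp Require Import ring lra.

Set Implicit Arguments.
Unset Strict Implicit.
Unset Printing Implicit Defensive.

Import Order.TTheory GRing.Theory Num.Theory.
Import numFieldNormedType.Exports.

Local Open Scope classical_set_scope.
Local Open Scope ring_scope.
Local Open Scope sesquilinear_scope.

(* The iteration is alternating maximization of f(Q, B) = Re Tr(Q^H X B) over
   isometries Q and unimodular B: unt maximizes f in Q, the maximum being the
   nuclear norm of X B, and sgn maximizes f in B, the maximum being the entrywise
   1-norm of X^H Q. Hence the nuclear norm never decreases. The same variational
   formula makes the nuclear norm Lipschitz, so it attains its maximum on the
   compact set of unimodular matrices. *)

(** * Conjugate transposes and Gram matrices *)

Lemma conjtr_mul (C : numClosedFieldType) p q r
    (M : 'M[C]_(p, q)) (M' : 'M[C]_(q, r)) : (M *m M') ^t* = M' ^t* *m M ^t*.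
Proof. by rewrite trmx_mul map_mxM. Qed.

Lemma conjtr_mulE (C : numClosedFieldType) m n p
    (M : 'M[C]_(m, n)) (N : 'M[C]_(m, p)) a b :
  (M ^t* *m N) a b = \sum_i (M i a)^* * N i b.
Proof. by rewrite mxE; apply: eq_bigr => i _; rewrite !mxE. Qed.

Lemma gram_diag_ge0 (C : numClosedFieldType) m n (M : 'M[C]_(m, n)) j :
  0 <= (M ^t* *m M) j j.
Proof.
by rewrite conjtr_mulE sumr_ge0// => i _; rewrite mulrC -normCK exprn_ge0.
Qed.

Lemma gram_diag_eq0 (C : numClosedFieldType) m n (M : 'M[C]_(m, n)) j :
  (M ^t* *m M) j j = 0 -> forall i, M i j = 0.
Proof.
move=> /eqP; rewrite conjtr_mulE psumr_eq0 => [|l _]; last first.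
  by rewrite mulrC -normCK exprn_ge0.
move=> /allP M0 i; have := M0 i.
by rewrite mem_index_enum mulrC -normCK sqrf_eq0 normr_eq0 => /(_ isT)/eqP.
Qed.

Lemma continuous_sum (K : numFieldType) (T : topologicalType) (I : Type) (r : seq I)
    (f : I -> T -> K) :
  (forall i, continuous (f i)) -> continuous (fun x => \sum_(i <- r) f i x).
Proof. by move=> cf; apply: continuous_big => //; exact: add_continuous. Qed.

(** * Real parts of traces and the entrywise 1-norm *)

Section ReTrace.
Context {R : realType}.
Local Notation C := R[i].
Local Notation Re := (@complex.Re R).
Local Notation Im := (@complex.Im R).

Lemma Re_sum (I : finType) (F : I -> C) : Re (\sum_i F i) = \sum_i Re (F i).
Proof. by apply: (big_morph _ _ _) => // -[? ?] [? ?]. Qed.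

Lemma Im_sum (I : finType) (F : I -> C) : Im (\sum_i F i) = \sum_i Im (F i).
Proof. by apply: (big_morph _ _ _) => // -[? ?] [? ?]. Qed.

(** The modulus on [R[i]] takes its values in [R[i]]; applying [Re] reads it as an element of [R],
    here and below. *)
Lemma Re_le_norm (z : C) : Re z <= Re `|z|.
Proof.
by have := normc_ge_Re z; rewrite lecE => /andP[_]; apply: le_trans; apply: ler_norm.
Qed.

Lemma Re_norm_le (z : C) : Re `|z| <= `|Re z| + `|Im z|.
Proof.
rewrite normc_def /= -[leRHS]ger0_norm ?addr_ge0// -sqrtr_sqr ler_sqrt ?sqr_ge0//.
by rewrite sqrrD !real_normK ?num_real// lerD2r lerDl mulrn_wge0 ?mulr_ge0.
Qed.

Lemma trace_conjtr_mulE m n (A B : 'M[C]_(m, n)) :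
  \tr (A ^t* *m B) = \sum_i \sum_j (A i j)^* * B i j.
Proof.
rewrite exchange_big; apply: eq_bigr => j _; rewrite mxE.
by apply: eq_bigr => i _; rewrite !mxE.
Qed.

(** Duality of the entrywise sup norm and 1-norm. It serves for unimodular matrices and, through
    [isometry_entry_le1], for isometries. *)
Lemma Re_trace_le m n (A B : 'M[C]_(m, n)) : (forall i j, `|A i j| <= 1) ->
  Re (\tr (A ^t* *m B)) <= \sum_i \sum_j Re `|B i j|.
Proof.
move=> A1; rewrite trace_conjtr_mulE Re_sum; apply: ler_sum => i _.
rewrite Re_sum; apply: ler_sum => j _.
apply: le_trans (Re_le_norm _) _.
have : `|(A i j)^* * B i j| <= `|B i j|.
  by rewrite normrM norm_conjC ler_piMl.
by rewrite lecE => /andP[].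
Qed.

Lemma Re_trace_conj m n (A B : 'M[C]_(m, n)) :
  Re (\tr (A ^t* *m B)) = Re (\tr (B ^t* *m A)).
Proof.
have ReJ (z : C) : Re z = Re z^* by case: z.
rewrite !trace_conjtr_mulE ReJ; congr Re.
rewrite rmorph_sum; apply: eq_bigr => i _; rewrite rmorph_sum.
by apply: eq_bigr => j _; rewrite rmorphM /= conjCK mulrC.
Qed.

Lemma is_sgn_unimodular m n (A S : 'M[C]_(m, n)) : is_sgn A S -> unimodular S.
Proof.
move=> AS i j; have [nz z] := AS i j.
have [/z//|A0] := eqVneq (A i j) 0.
by rewrite nz// normrM normfV normr_id mulfV ?normr_eq0.
Qed.

(** Equality case of [Re_trace_le]: conj(a) a / |a| = |a| at a nonzero entry a, and a zero entry
    contributes 0 whichever sign is chosen. *)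
Lemma is_sgn_trace m n (A S : 'M[C]_(m, n)) : is_sgn A S ->
  Re (\tr (A ^t* *m S)) = \sum_i \sum_j Re `|A i j|.
Proof.
move=> AS; rewrite trace_conjtr_mulE Re_sum; apply: eq_bigr => i _.
rewrite Re_sum; apply: eq_bigr => j _; congr Re.
have [nz _] := AS i j.
have [->|A0] := eqVneq (A i j) 0; first by rewrite conjC0 mul0r normr0.
by rewrite nz// mulrA [_^* * _]mulrC -normCK expr2 mulfK ?normr_eq0.
Qed.

(** * Isometries: bound on the entries and completion of partial ones *)

Lemma isometry_entry_le1 m n (Q : 'M[C]_(m, n)) : Q ^t* *m Q = 1%:M ->
  forall i j, `|Q i j| <= 1.
Proof.
move=> /matrixP QQ i j; have := QQ j j; rewrite !mxE eqxx mulr1n => Q1.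
rewrite -(@expr_le1 _ 2)// -[leRHS]Q1 (bigD1 i)//= !mxE mulrC -normCK lerDl.
by apply: sumr_ge0 => k _; rewrite !mxE mulrC -normCK exprn_ge0.
Qed.

(* Induction on the number of zero columns: a zero column forces \rank E < m, so
   some unit vector is orthogonal to all columns of E; it replaces that column. *)
Lemma isometry_extension m n (E : 'M[C]_(m, n)) (p : pred 'I_n) : (n <= m)%N ->
  E ^t* *m E = diag_mx (\row_j (p j)%:R) ->
  exists2 Q : 'M[C]_(m, n), Q ^t* *m Q = 1%:M &
    forall i j, p j -> Q i j = E i j.
Proof.
move=> nm; have [k] := ubnP #|predC p|; elim: k => // k IHk in E p *.
rewrite ltnS => pk EE; have [/existsP[j0 pj0]|] := boolP [exists j, ~~ p j]; last first.
  rewrite negb_exists => /forallP pT; exists E => //; rewrite EE.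
  apply/matrixP => a b; rewrite !mxE; move: (pT a); rewrite negbK => ->.
  by [].
have E0 i : E i j0 = 0.
  by apply: gram_diag_eq0; rewrite EE !mxE eqxx (negPf pj0).
have rkE : (\rank E < m)%N.
  apply: leq_trans nm; rewrite ltn_neqAle rank_leq_col andbT.
  apply/negP => rE; have : row_free E^T by rewrite /row_free mxrank_tr.
  (* The zero column puts a nonzero basis vector in the left kernel of [E^T], against full rank. *)
  have dE : delta_mx 0 j0 *m E^T = 0 :> 'rV_m.
    by rewrite -rowE; apply/rowP => i; rewrite !mxE E0.
  rewrite -kermx_eq0 => /eqP kE.
  have : ((delta_mx 0 j0 : 'rV[C]_n) <= kermx E^T)%MS by apply/sub_kermxP.
  by rewrite kE submx0 => /eqP/rowP/(_ j0)/eqP; rewrite !mxE !eqxx oner_eq0.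
have /rowV0Pn[y yE ynz] : kermx E != 0.
  by rewrite -mxrank_eq0 mxrank_ker -lt0n subn_gt0.
have {}yE : y *m E = 0 by apply/sub_kermxP.
pose s := \sum_i `|y 0 i| ^+ 2.
have s_gt0 : 0 < s.
  rewrite lt_neqAle sumr_ge0 ?andbT; last by move=> *; rewrite exprn_ge0.
  apply: contra ynz; rewrite eq_sym psumr_eq0 => [|l _]; last by rewrite exprn_ge0.
  move=> /allP y0; apply/eqP/rowP => i; rewrite mxE.
  by have := y0 i; rewrite mem_index_enum sqrf_eq0 normr_eq0 => /(_ isT)/eqP.
pose c := (sqrtC s)^-1.
have cc : c * c * s = 1.
  by rewrite -expr2 exprVn sqrtCK mulVf ?gt_eqF.
have c_real : c^* = c.
  by apply: CrealP; rewrite realV; apply: ger0_real; rewrite sqrtC_ge0 ltW.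
(* The equation [y *m E = 0] involves no conjugation, so the vector orthogonal to the columns of [E]
   for the Hermitian product is the conjugate of [y]; [c] gives it norm 1. *)
pose E' : 'M[C]_(m, n) := \matrix_(i, j) if j == j0 then c * (y 0 i)^* else E i j.
pose p' := [pred j | p j || (j == j0)].
have yE0 b : \sum_i y 0 i * E i b = 0.
  by move/rowP/(_ b): yE; rewrite !mxE.
have [] := IHk E' p'.
- apply: leq_trans pk; apply: proper_card; apply/properP; split.
    by apply/fintype.subsetP => j; rewrite !inE negb_or => /andP[].
  by exists j0; rewrite !inE ?eqxx ?orbT.
- apply/matrixP => a b; rewrite conjtr_mulE !mxE /=.
  have [aj|aj] := eqVneq a j0; have [bj|bj] := eqVneq b j0.
  + rewrite aj bj eqxx orbT mulr1n -[RHS]cc mulr_sumr; apply: eq_bigr => i _.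
    by rewrite !mxE eqxx rmorphM /= conjCK c_real mulrACA -normCK.
  + rewrite aj eq_sym (negPf bj) mulr0n.
    have := congr1 ( *%R c) (yE0 b); rewrite mulr0 mulr_sumr => cyE; rewrite -[RHS]cyE.
    apply: eq_bigr => i _.
    by rewrite !mxE eqxx (negPf bj) rmorphM /= conjCK c_real mulrA.
  + rewrite bj (negPf aj) mulr0n; have := congr1 (fun z => c * z^*) (yE0 a).
    rewrite conjC0 mulr0 rmorph_sum mulr_sumr => cyE; rewrite -[RHS]cyE.
    apply: eq_bigr => i _.
    by rewrite !mxE eqxx (negPf aj) rmorphM mulrCA; congr (_ * _); rewrite mulrC.
  + rewrite orbF; have := conjtr_mulE E E a b; rewrite EE !mxE => ->.
    by apply: eq_bigr => i _; rewrite !mxE (negPf aj) (negPf bj).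
move=> Q QQ QE'; exists Q => // i j pj; rewrite QE' /= ?pj// mxE.
by case: eqP pj pj0 => // -> ->.
Qed.


(** * Variational formula for the nuclear norm *)

Section NuclearNorm.
Context {m n : nat} (A : 'M[C]_(m, n)).
Let G := A ^t* *m A.
Let P := spectralmx G.
(** In SVD terms this is U Diag(s): [A] written in an eigenbasis of its Gram matrix, so that the
    columns are pairwise orthogonal with norms the singular values. *)
Let W := A *m P ^t*.
Let sv (j : 'I_n) : R := singular_values A 0 j.

Let PPt : P *m P ^t* = 1%:M.
Proof. exact/unitarymxP/spectral_unitarymx. Qed.

Let PtP : P ^t* *m P = 1%:M.
Proof. exact: mulmx1C. Qed.

Let WW : W ^t* *m W = diag_mx (spectral_diag G).
Proof.
have Gn : G \is normalmx by apply/normalmxP; rewrite /G conjtr_mul trmxCK.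
rewrite /W conjtr_mul trmxCK mulmxA -(mulmxA P) -/G.
rewrite [in LHS](orthomx_spectralP Gn) invmx_unitary ?spectral_unitarymx// -/P.
by rewrite !mulmxA PPt mul1mx -mulmxA PPt mulmx1.
Qed.

Let sv_ge0 j : 0 <= sv j.
Proof. by rewrite /sv mxE sqrtr_ge0. Qed.

Let sv_sqr j : (real_complex R (sv j)) ^+ 2 = spectral_diag G 0 j.
Proof.
have d_ge0 : 0 <= spectral_diag G 0 j.
  have : (W ^t* *m W) j j = spectral_diag G 0 j by rewrite WW !mxE eqxx mulr1n.
  by move=> <-; exact: gram_diag_ge0.
rewrite /sv mxE -rmorphXn /= sqr_sqrtr; last by move: d_ge0; rewrite lecE => /andP[].
by rewrite RRe_real ?ger0_real.
Qed.

Let trE (Q : 'M[C]_(m, n)) : \tr (Q ^t* *m A) = \tr ((Q *m P ^t*) ^t* *m W).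
Proof.
by rewrite /W conjtr_mul trmxCK mulmxA [RHS]mxtrace_mulC !mulmxA PtP mul1mx.
Qed.

Let W_col0 i j : sv j = 0 -> W i j = 0.
Proof.
move=> s0; have := sv_sqr j; rewrite s0 rmorph0 expr0n /= => d0.
by apply: gram_diag_eq0; rewrite WW !mxE eqxx mulr1n -d0.
Qed.

(* For the orthonormal columns q_j of Q P^H and the columns w_j of W, of norm s_j:
   0 <= |w_j - s_j q_j|^2 = 2 s_j^2 - 2 s_j Re <q_j, w_j>. *)
Lemma Re_trace_le_nuclear_norm (Q : 'M[C]_(m, n)) : Q ^t* *m Q = 1%:M ->
  Re (\tr (Q ^t* *m A)) <= nuclear_norm A.
Proof.
move=> QQ; rewrite trE; set Q' := Q *m P ^t*.
have Q'Q' : Q' ^t* *m Q' = 1%:M.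
  by rewrite /Q' conjtr_mul trmxCK mulmxA -(mulmxA P) QQ mulmx1 PPt.
rewrite /mxtrace Re_sum; apply: ler_sum => j _; rewrite -/(sv j).
(* The case s_j = 0 is split off because the final inequality is obtained by cancelling a factor
   s_j; there the column of [W] vanishes. *)
have [s0|s_neq0] := eqVneq (sv j) 0.
  by rewrite s0 conjtr_mulE big1// => i _; rewrite W_col0 ?mulr0.
have s_gt0 : 0 < sv j by rewrite lt_neqAle eq_sym s_neq0 sv_ge0.
set s := real_complex R (sv j).
have sJ : s^* = s by apply: CrealP; rewrite complex_real.
have : 0 <= \sum_i (W i j - s * Q' i j)^* * (W i j - s * Q' i j).
  by apply: sumr_ge0 => i _; rewrite mulrC -normCK exprn_ge0.
have -> : \sum_i (W i j - s * Q' i j)^* * (W i j - s * Q' i j)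
   = (W ^t* *m W) j j - s * (Q' ^t* *m W) j j - s * (W ^t* *m Q') j j
     + s ^+ 2 * (Q' ^t* *m Q') j j.
  rewrite !conjtr_mulE !mulr_sumr -!sumrB -big_split /=; apply: eq_bigr => i _.
  rewrite rmorphB rmorphM /= sJ; ring.
have -> : (W ^t* *m W) j j = s ^+ 2 by rewrite WW !mxE eqxx mulr1n -sv_sqr.
have -> : (Q' ^t* *m Q') j j = 1 by rewrite Q'Q' !mxE eqxx.
have -> : (W ^t* *m Q') j j = ((Q' ^t* *m W) j j)^*.
  rewrite !conjtr_mulE rmorph_sum; apply: eq_bigr => i _.
  by rewrite rmorphM /= conjCK mulrC.
rewrite expr2 lecE => /andP[_].
case: ((Q' ^t* *m W) j j) => a b; rewrite /s /= => h.
rewrite -(ler_pM2l s_gt0); lra.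
Qed.

(** Normalizing the nonzero columns of [W] gives a partial isometry; any completion of it is
    optimal, since the remaining columns meet only zero columns of [W]. *)
Lemma nuclear_norm_attained : (n <= m)%N ->
  exists2 Q : 'M[C]_(m, n), Q ^t* *m Q = 1%:M &
    Re (\tr (Q ^t* *m A)) = nuclear_norm A.
Proof.
move=> nm.
pose sC j := real_complex R (sv j).
have sC0 j : (sC j == 0) = (sv j == 0) by rewrite fmorph_eq0.
have sCJ j : (sC j)^* = sC j by apply: CrealP; rewrite complex_real.
(* Division by zero yields 0, so columns with zero singular value are zero, as the 0/1 diagonal Gram
   matrix in [isometry_extension] demands. *)
pose E : 'M[C]_(m, n) := \matrix_(i, j) (W i j / sC j).
have [] := @isometry_extension _ _ E [pred j | sv j != 0] nm.
  apply/matrixP => a b; rewrite conjtr_mulE.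
  have -> : \sum_i (E i a)^* * E i b = (sC a)^-1 * (sC b)^-1 * (W ^t* *m W) a b.
    rewrite conjtr_mulE mulr_sumr; apply: eq_bigr => i _.
    by rewrite !mxE rmorphM fmorphV /= sCJ; ring.
  rewrite WW !mxE; have [->|ab] := eqVneq a b; last by rewrite !mulr0n mulr0.
  rewrite !mulr1n -sv_sqr -/(sC b) /= -sC0.
  have [->|s0] := eqVneq (sC b) 0; first by rewrite expr0n mulr0.
  by rewrite -invfM -expr2 mulVf// sqrf_eq0.
(* [Q'] is optimal in the eigenbasis; multiplying by [P] returns to the original basis. *)
move=> Q' Q'Q' Q'E; exists (Q' *m P).
  by rewrite conjtr_mul mulmxA -(mulmxA _ _ Q') Q'Q' mulmx1 PtP.
rewrite trE -(mulmxA Q') PPt mulmx1 /mxtrace Re_sum; apply: eq_bigr => j _.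
rewrite -/(sv j); have [s0|s_neq0] := eqVneq (sv j) 0.
  by rewrite s0 conjtr_mulE big1// => i _; rewrite W_col0 ?mulr0.
suff -> : (Q' ^t* *m W) j j = sC j by [].
transitivity ((sC j)^-1 * (W ^t* *m W) j j).
  rewrite !conjtr_mulE mulr_sumr; apply: eq_bigr => i _.
  by rewrite Q'E//= !mxE rmorphM fmorphV /= sCJ; ring.
rewrite WW !mxE eqxx mulr1n -sv_sqr -/(sC j) expr2 mulKf// sC0//.
Qed.

Lemma is_unt_nuclear_norm (Q : 'M[C]_(m, n)) : (n <= m)%N -> is_unt A Q ->
  Re (\tr (Q ^t* *m A)) = nuclear_norm A.
Proof.
move=> nm [QQ Qmax]; apply/eqP; rewrite eq_le Re_trace_le_nuclear_norm//=.
by have [P' P'P' <-] := nuclear_norm_attained nm; exact: Qmax.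
Qed.

End NuclearNorm.

(** * Lipschitz bound and continuity of the nuclear norm *)

Lemma nuclear_norm_le_add m n (A B : 'M[C]_(m, n)) : (n <= m)%N ->
  nuclear_norm A <= nuclear_norm B + \sum_i \sum_j Re `|(A - B) i j|.
Proof.
(* An isometry optimal for [A] is a competitor for [B]; the difference [A - B] is controlled by the
   bound 1 on its entries. *)
move=> nm; have [Q QQ <-] := nuclear_norm_attained A nm.
rewrite -{1}(subrK B A) addrC mulmxDr raddfD /=.
have ReD (x y : C) : Re (x + y) = Re x + Re y by case: x; case: y.
rewrite ReD; apply: lerD; first exact: Re_trace_le_nuclear_norm.
by apply: Re_trace_le => i j; exact: isometry_entry_le1.
Qed.

(** The Lipschitz bound squeezes the variation under [d], which is continuous and vanishes at [t].
    Working with real and imaginary parts keeps all limits in [R]. *)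
Lemma continuous_nuclear_norm (T : topologicalType) m n (F : T -> 'M[C]_(m, n)) :
  (n <= m)%N ->
  (forall i j, continuous (fun t => Re (F t i j))) ->
  (forall i j, continuous (fun t => Im (F t i j))) ->
  continuous (fun t => nuclear_norm (F t)).
Proof.
move=> nm cRe cIm t.
pose d s := \sum_i \sum_j (`|Re (F t i j) - Re (F s i j)|
                         + `|Im (F t i j) - Im (F s i j)|).
have d_bound s : `|nuclear_norm (F t) - nuclear_norm (F s)| <= d s.
  have ent (A B : 'M[C]_(m, n)) i j : Re `|(A - B) i j| <=
      `|Re (A i j) - Re (B i j)| + `|Im (A i j) - Im (B i j)|.
    apply: le_trans (Re_norm_le _) _; rewrite !mxE.
    by case: (A i j); case: (B i j).
  rewrite ler_norml; apply/andP; split.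
    rewrite lerBrDl lerBlDr.
    apply: le_trans (nuclear_norm_le_add (F s) (F t) nm) _.
    rewrite lerD2l; apply: ler_sum => i _; apply: ler_sum => j _.
    by apply: le_trans (ent _ _ _ _) _; rewrite distrC [X in _ + X]distrC.
  rewrite lerBlDl; apply: le_trans (nuclear_norm_le_add (F t) (F s) nm) _.
  rewrite lerD2l; apply: ler_sum => i _; apply: ler_sum => j _; exact: ent.
have d_cont : continuous d.
  apply: continuous_sum => i; apply: continuous_sum => j s.
  by apply: cvgD; apply: cvg_norm; apply: cvgB; [exact: cvg_cst|exact: cRe
    |exact: cvg_cst|exact: cIm].
have d0 : d s @[s --> t] --> 0.
  suff <- : d t = 0 by exact: d_cont.
  by rewrite /d big1// => i _; rewrite big1// => j _; rewrite !subrr normr0 addr0.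
apply/cvgrPdist_lt => e e0.
have /cvgr_lt/(_ _ e0) := d0.
by apply: filterS => s /=; apply: le_lt_trans; exact: d_bound.
Qed.

Lemma continuous_nuclear_norm_mulmx (T : topologicalType) m n p (X : 'M[C]_(m, n))
    (F : T -> 'M[C]_(n, p)) :
  (p <= m)%N ->
  (forall k j, continuous (fun t => Re (F t k j))) ->
  (forall k j, continuous (fun t => Im (F t k j))) ->
  continuous (fun t => nuclear_norm (X *m F t)).
Proof.
move=> pm cRe cIm; apply: continuous_nuclear_norm => // i j.
  have -> : (fun t => Re ((X *m F t) i j)) =
    (fun t => \sum_k (Re (X i k) * Re (F t k j) - Im (X i k) * Im (F t k j))).
    apply/funext => t; rewrite mxE Re_sum; apply: eq_bigr => k _.
    by case: (X i k); case: (F t k j).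
  apply: continuous_sum => k t.
  by apply: cvgB; apply: cvgM; [exact: cvg_cst|exact: cRe|exact: cvg_cst|exact: cIm].
have -> : (fun t => Im ((X *m F t) i j)) =
  (fun t => \sum_k (Re (X i k) * Im (F t k j) + Im (X i k) * Re (F t k j))).
  apply/funext => t; rewrite mxE Im_sum; apply: eq_bigr => k _.
  by case: (X i k); case: (F t k j).
apply: continuous_sum => k t.
by apply: cvgD; apply: cvgM; [exact: cvg_cst|exact: cIm|exact: cvg_cst|exact: cRe].
Qed.

End ReTrace.

(** * Compactness of the unimodular matrices and existence of a maximizer *)

Lemma compact_circle (R : realType) :
  compact [set p : R * R | p.1 * p.1 + p.2 * p.2 = 1].
Proof.
have cl1 : closed [set p : R * R | p.1 * p.1 + p.2 * p.2 = 1].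
  apply: (@preimage_closed _ _ (fun p : R * R => p.1 * p.1 + p.2 * p.2) [set 1]).
    by move=> p _; apply: cvgD; apply: cvgM; solve [exact: cvg_fst|exact: cvg_snd].
  exact: closed_eq.
apply: (subclosed_compact cl1
  (compact_setX (@segment_compact R (-1) 1) (@segment_compact R (-1) 1))).
move=> [a b] /= ab; rewrite !in_itv /=; split; apply/andP; split; nra.
Qed.

Section MaxNorm.
Import ArrowAsProduct.

Lemma nuclear_norm_unimodular_max (R : realType) (D N K : nat) (X : 'M[R[i]]_(D, N)) :
  (K <= D)%N ->
  exists2 B : 'M[R[i]]_(N, K), unimodular B &
    forall B' : 'M[R[i]]_(N, K), unimodular B' -> nuclear_norm (X *m B') <= nuclear_norm (X *m B).
Proof.
move=> KD.
pose circle := [set p : R * R | p.1 * p.1 + p.2 * p.2 = 1].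
(* Matrices are encoded as families of real pairs, so that the unimodular ones become a product of
   circles, compact by Tychonoff's theorem. *)
pose T := prod_topology (fun _ : 'I_N * 'I_K => (R * R)%type).
pose mx (f : T) : 'M[R[i]]_(N, K) := \matrix_(k, j) Complex (f (k, j)).1 (f (k, j)).2.
pose box : set T := [set f | forall kj, circle (f kj)].
have norm1 (z : R[i]) : (`|z| = 1) <-> circle (complex.Re z, complex.Im z).
  case: z => a b; rewrite normc_def /=; split => [[ab]|ab].
    rewrite /circle/= -!expr2 -(sqr_sqrtr (addr_ge0 (sqr_ge0 a) (sqr_ge0 b))).
    by rewrite ab expr1n.
  by rewrite !expr2 ab sqrtr1.
have mx_unimodular f : box f -> unimodular (mx f).
  by move=> bf k j; apply/norm1; rewrite mxE; exact: bf.
have unimodular_mx B : unimodular B -> exists2 f, box f & mx f = B.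
  move=> uB; exists (fun kj => (complex.Re (B kj.1 kj.2), complex.Im (B kj.1 kj.2))).
    by move=> kj; apply/norm1/uB.
  by apply/matrixP => k j; rewrite mxE /=; case: (B k j).
have cbox : compact box.
  by apply: (@tychonoff _ (fun=> (R * R)%type) (fun=> circle)) => _; exact: compact_circle.
have box0 : box !=set0.
  by exists (fun=> (1, 0)) => kj /=; rewrite /circle /= mulr1 mulr0 addr0.
have cproj kj : continuous (fun f : T => f kj) by exact: proj_continuous.
have c1 kj : continuous (fun f : T => (f kj).1).
  move=> f; apply: (cvg_comp (fun f : T => f kj) fst); [exact: cproj|exact: cvg_fst].
have c2 kj : continuous (fun f : T => (f kj).2).
  move=> f; apply: (cvg_comp (fun f : T => f kj) snd); [exact: cproj|exact: cvg_snd].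
have cF : continuous (fun f => nuclear_norm (X *m mx f)).
  apply: (@continuous_nuclear_norm_mulmx R T) => // k j.
    suff -> : (fun f => complex.Re (mx f k j)) = (fun f => (f (k, j)).1) by exact: c1.
    by apply/funext => f; rewrite mxE.
  suff -> : (fun f => complex.Im (mx f k j)) = (fun f => (f (k, j)).2) by exact: c2.
  by apply/funext => f; rewrite mxE.
have [|f /set_mem bf fmax] := compact_EVT_max box0 cbox (f := fun f => nuclear_norm (X *m mx f)).
  exact: continuous_subspaceT.
exists (mx f); first exact: mx_unimodular.
by move=> _ /unimodular_mx[g bg <-]; apply: fmax; exact/mem_set.
Qed.

End MaxNorm.

(** * Monotonicity and convergence of the iteration *)

Theorem mainTheorem3 (R : realType) (D N K : nat) (X : 'M[R[i]]_(D, N))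
    (hK1 : (1 <= K)%N) (hKr : (K < \rank X)%N)
    (B : nat -> 'M[R[i]]_(N, K))
    (hB0 : unimodular (B 0%N))
    (hB : forall i : nat, (1 <= i)%N ->
       exists2 Q : 'M[R[i]]_(D, K),
         is_unt (X *m B i.-1) Q & is_sgn (X ^t* *m Q) (B i)) :
  let u : nat -> R := fun i => nuclear_norm (X *m B i) in
  let values : set R :=
    [set nuclear_norm (X *m A) | A in @unimodular R N K] in
  [/\ cvgn u,
      nondecreasing_seq u &
      exists M : R,
        [/\ values M,
            ubound values M &
            forall i : nat, (1 <= i)%N -> u i.-1 <= u i /\ u i <= M]].
Proof.
move=> u values.
(* This makes room for K orthonormal columns in dimension D, as attainment of the nuclear norm
   requires. *)
have KD : (K <= D)%N by apply: leq_trans (ltnW hKr) (rank_leq_row X).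
have uniB i : unimodular (B i).
  by case: i => [//|i]; have [//|Q _ /is_sgn_unimodular] := hB i.+1.
(* With Q the chosen value of unt(X B_i): ||X B_i||_* = Re Tr(Q^H X B_i) <= ||X^H Q||_1 = Re Tr(Q^H
   X B_{i+1}) <= ||X B_{i+1}||_*, where ||.||_1 is the entrywise 1-norm. *)
have step i : u i <= u i.+1.
  have [//|Q Qunt Qsgn] := hB i.+1.
  have trQ A : \tr (Q ^t* *m (X *m A)) = \tr ((X ^t* *m Q) ^t* *m A).
    by rewrite conjtr_mul trmxCK mulmxA.
  (* The swap by [Re_trace_conj] puts the unimodular factor first, where [Re_trace_le] expects the
     entries bounded by 1. *)
  rewrite /u -(is_unt_nuclear_norm KD Qunt) /= trQ Re_trace_conj.
  apply: le_trans (Re_trace_le _ _) _; first by move=> k j; rewrite uniB.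
  rewrite -(is_sgn_trace Qsgn) -trQ.
  by apply: Re_trace_le_nuclear_norm; case: Qunt.
have [Bmax uBmax max] := nuclear_norm_unimodular_max X KD.
have ndu : nondecreasing_seq u by apply/nondecreasing_seqP.
split=> //.
  by apply: nondecreasing_is_cvgn => //; exists (nuclear_norm (X *m Bmax)) => _ [i _ <-];
    exact: max.
exists (nuclear_norm (X *m Bmax)); split.
- by exists Bmax.
- by move=> _ [A uA <-]; exact: max.
- by move=> [//|i] _; split; [exact: step|exact: max].
Qed.
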